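(* Let $\mu\ge1$ and $m\ge1$ be integers. Then, as formal power series in $t$, $$\sum_{n=0}^\infty B_{n,\le m}^{(\mu)}\frac{t^n}{n!}=\frac{\mathrm{Li}_\mu\bigl(1-E_m(-t)\bigr)}{1-E_m(-t)} \quad\text{and}\quad \sum_{n=0}^\infty B_{n,\ge m}^{(\mu)}\frac{t^n}{n!}=\frac{\mathrm{Li}_\mu\bigl(E_{m-1}(-t)-e^{-t}\bigr)}{E_{m-1}(-t)-e^{-t}},$$ where for a power series $z$ with zero constant term, $\mathrm{Li}_\mu(z)/z$ means $\sum_{k\ge0} z^k/(k+1)^\mu$.
   Context: $E_m(t)=\sum_{k=0}^m \frac{t^k}{k!}$ (so $E_0(t)=1$). $\mathrm{Li}_\mu(z)=\sum_{j\ge1} z^j/j^\mu$ is the polylogarithm. For integers $n,k\ge0$, $m\ge1$, $\left\{ {n \atop k} \right\}_{\le m}$ (resp. $\left\{ {n \atop k} \right\}_{\ge m}$) is the number of partitions of an $n$-element set into $k$ nonempty blocks each of size at most $m$ (resp. at least $m$), with the value $1$ for $n=k=0$. The restricted and associated poly-Bernoulli numbers are $$B_{n,\le m}^{(\mu)}=\sum_{k=0}^n(-1)^{n-k}\frac{k!}{(k+1)^\mu}\left\{ {n \atop k} \right\}_{\le m},\qquad B_{n,\ge m}^{(\mu)}=\sum_{k=0}^n(-1)^{n-k}\frac{k!}{(k+1)^\mu}\left\{ {n \atop k} \right\}_{\ge m}\qquad(n\ge0).$$ *)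

(* Defs.v *)
From mathcomp Require Import all_boot all_order all_algebra.
Set Implicit Arguments. Unset Strict Implicit. Unset Printing Implicit Defensive.
Import GRing.Theory.
Local Open Scope ring_scope.

(* A formal power series over the rationals is its coefficient sequence;
   equality of series is coefficientwise equality [=1]. *)
Definition fps := nat -> rat.

Definition fps_one : fps := fun n => (n == 0%N)%:R.
Definition fps_sub (f g : fps) : fps := fun n => f n - g n.
Definition fps_mul (f g : fps) : fps :=
  fun n => \sum_(i < n.+1) f i * g (n - i)%N.
Definition fps_exp (f : fps) (k : nat) : fps := iter k (fps_mul f) fps_one.

(* f(-t) *)
Definition fps_negvar (f : fps) : fps := fun n => (-1) ^+ n * f n.

(* \sum_(k >= 0) c_k z^k, for z with zero constant term: the powers z^k with
   k > n do not contribute to the coefficient of t^n, see [fps_comp_cvg]. *)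
Definition fps_comp (c z : fps) : fps :=
  fun n => \sum_(k < n.+1) c k * fps_exp z k n.

Definition expseries : fps := fun k => (k`!%:R)^-1.
Definition E_ (m : nat) : fps := fun k => if (k <= m)%N then (k`!%:R)^-1 else 0.

Definition polylog (mu : nat) : fps :=
  fun j => if j is 0 then 0 else (j%:R ^+ mu)^-1.

(* Li_mu(z) / z := \sum_(k >= 0) z^k / (k+1)^mu *)
Definition polylog_div (mu : nat) (z : fps) : fps :=
  fps_comp (fun k => (k.+1%:R ^+ mu)^-1) z.

Definition egf (a : nat -> rat) : fps := fun n => a n / n`!%:R.

(* [partition] already requires the blocks to be nonempty. *)
Definition stirling2_le (m n k : nat) : nat :=
  #|[set P : {set {set 'I_n}} | [&& partition P [set: 'I_n], #|P| == k
       & [forall B in P, (#|B| <= m)%N]]]|.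
Definition stirling2_ge (m n k : nat) : nat :=
  #|[set P : {set {set 'I_n}} | [&& partition P [set: 'I_n], #|P| == k
       & [forall B in P, (m <= #|B|)%N]]]|.

Definition polyBernoulli_le (mu m n : nat) : rat :=
  \sum_(k < n.+1)
    (-1) ^+ (n - k) * (k`!%:R / k.+1%:R ^+ mu) * (stirling2_le m n k)%:R.
Definition polyBernoulli_ge (mu m n : nat) : rat :=
  \sum_(k < n.+1)
    (-1) ^+ (n - k) * (k`!%:R / k.+1%:R ^+ mu) * (stirling2_ge m n k)%:R.

Lemma fps_exp_val (z : fps) k n : z 0%N = 0 -> (n < k)%N -> fps_exp z k n = 0.
Proof.
move=> z0; elim: k n => // k IH n ltnk.
change (fps_mul z (fps_exp z k) n = 0); apply: big1 => -[[|i] lti] _ /=.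
  by rewrite z0 mul0r.
rewrite IH ?mulr0 //.
by case: n ltnk lti => // n ltnk lti; rewrite subSS (leq_ltn_trans (leq_subr _ _)).
Qed.

(* [fps_comp c z] is the t-adic limit of the partial sums of \sum_k c_k z^k. *)
Lemma fps_comp_cvg (c z : fps) n N : z 0%N = 0 -> (n < N)%N ->
  \sum_(k < N) c k * fps_exp z k n = fps_comp c z n.
Proof.
move=> z0 ltnN; rewrite /fps_comp [RHS](big_ord_widen N (fun k => c k * fps_exp z k n)) //.
rewrite [RHS]big_mkcond /=; apply: eq_bigr => k _.
by case: ltnP => // ltnk; rewrite fps_exp_val ?mulr0.
Qed.

Lemma mul_polylog_div mu (z : fps) : z 0%N = 0 ->
  fps_mul z (polylog_div mu z) =1 fps_comp (polylog mu) z.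
Proof.
move=> z0 n; rewrite -(@fps_comp_cvg _ _ n n.+2) // big_ord_recl /= mul0r add0r.
under [RHS]eq_bigr => k _ do rewrite {1}/fps_mul mulr_sumr.
rewrite exchange_big /=; apply: eq_bigr => i _.
rewrite /polylog_div -(@fps_comp_cvg _ _ _ n.+1) ?ltnS ?leq_subr // mulr_sumr.
by apply: eq_bigr => k _; rewrite mulrCA.
Qed.

Lemma stirling2_le00 m : stirling2_le m 0 0 = 1%N.
Proof.
rewrite /stirling2_le -(cards1 (set0 : {set {set 'I_0}})); apply: eq_card => P.
rewrite !inE cards_eq0; case: eqP => [->|_]; last by rewrite andbF.
rewrite /partition /cover /trivIset /cover !big_set0 cards0 eqxx inE /= andbT.
apply/andP; split; first by apply/eqP/setP => -[].
by apply/forallP => B; rewrite inE.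
Qed.

Lemma stirling2_ge00 m : stirling2_ge m 0 0 = 1%N.
Proof.
rewrite /stirling2_ge -(cards1 (set0 : {set {set 'I_0}})); apply: eq_card => P.
rewrite !inE cards_eq0; case: eqP => [->|_]; last by rewrite andbF.
rewrite /partition /cover /trivIset /cover !big_set0 cards0 eqxx inE /= andbT.
apply/andP; split; first by apply/eqP/setP => -[].
by apply/forallP => B; rewrite inE.
Qed.

(* Main.v *)
Require Import Defs.
From mathcomp Require Import all_boot all_order all_algebra.
From mathcomp Require Import zify ring.
Set Implicit Arguments. Unset Strict Implicit. Unset Printing Implicit Defensive.
Import Order.TTheory GRing.Theory Num.Theory.

(** Fix a set [a] of allowed block sizes and let [w] be the series
    \sum_(j >= 1, a j) t^j / j!.  Counting pairs (partition of an n-set into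
    k+1 allowed blocks, distinguished block) in two ways gives
    (k+1) S(n, k+1) = \sum_(j >= 1, a j) C(n, j) S(n-j, k), which is exactly
    the recursion w^(k+1) = w * w^k, so k! S(n, k) / n! is the coefficient of
    t^n in w^k.  Both series substituted into Li_mu(z) / z are
    z(t) = - w(-t), for [a] = (<= m) and [a] = (>= m), and
    z^k then has n-th coefficient (-1)^(n-k) k! S(n, k) / n!. *)

(** The ground set is an arbitrary subset [A] of [T], so that removing a block [B] leaves an object
    of the same kind, on [A :\: B]. *)
Definition block_partitions (T : finType) (a : pred nat) (A : {set T}) (k : nat)
    : {set {set {set T}}} :=
  [set P | [&& partition P A, #|P| == k & [forall B in P, a #|B|]]].

Definition block_series (a : pred nat) : fps :=
  fun j => if (0 < j)%N && a j then (j`!%:R)^-1%R else 0%R.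

Lemma fps_expS (f : fps) k : fps_exp f k.+1 = fps_mul f (fps_exp f k).
Proof. by []. Qed.

Section BlockPartitions.

Variables (T : finType) (a : pred nat).
Implicit Types (A B : {set T}) (P : {set {set T}}).

Lemma block_partitions0 A :
  #|block_partitions a A 0| = (A == set0).
Proof.
have [->|A0] := eqVneq A set0.
  transitivity #|[set (set0 : {set {set T}})]|; last by rewrite cards1.
  apply: eq_card => P.
  rewrite !inE partition_set0 cards_eq0; case: eqP => //= ->.
  by apply/forallP => B; rewrite inE.
apply/eqP; rewrite cards_eq0; apply/eqP/setP => P; rewrite !inE cards_eq0.
apply/negP => /and3P[/cover_partition covP /eqP P0 _].
by move: A0; rewrite -covP P0 /cover big_set0 eqxx.
Qed.

(** Deleting the block [B] is a bijection onto the partitions of [A :\: B], with inverse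
    [B |: P]. *)
Lemma card_block_partitions_mem A B k :
  #|[set P in block_partitions a A k.+1 | B \in P]| =
  if [&& B \subset A, (0 < #|B|)%N & a #|B|]
  then #|block_partitions a (A :\: B) k| else 0%N.
Proof.
case: ifP => [/and3P[sBA B0 aB]|nB]; last first.
  apply/eqP; rewrite cards_eq0; apply/eqP/setP => P; rewrite !inE.
  apply/negP => /andP[/and3P[partP _ /forall_inP aP] BP].
  move/negP: nB; apply; rewrite (partitionS partP BP) aP // andbT.
  by rewrite card_gt0 (partition_neq0 partP BP).
(* A block of a partition of [A :\: B] equal to [B] would be disjoint from itself, hence empty. *)
have notin P : P \in block_partitions a (A :\: B) k -> B \notin P.
  rewrite inE => /and3P[partP _ _]; apply: contraTN B0 => BP.
  have := partitionS partP BP; rewrite subsetD => /andP[_].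
  by rewrite -setI_eq0 setIid => /eqP ->; rewrite cards0.
have injB : {in block_partitions a (A :\: B) k &,
    injective (fun P => B |: P)}.
  move=> P Q /notin nP /notin nQ /= eqPQ.
  by rewrite -(setU1K nP) -(setU1K nQ) eqPQ.
rewrite -(card_in_imset injB); apply: eq_card => P; rewrite inE.
apply/andP/imsetP => [[PA BP]|[Q QA ->]].
  move: PA; rewrite inE => /and3P[partP cP /forall_inP aP].
  exists (P :\ B); rewrite ?setD1K // inE partitionD1 //=.
  rewrite (cardsD1 B) BP add1n eqSS in cP; rewrite cP /=.
  by apply/forall_inP => C /setD1P[_ /aP].
have nQ := notin _ QA; move: QA; rewrite !inE eqxx.
move=> /and3P[partQ cQ /forall_inP aQ]; split=> //; apply/and3P; split.
- have -> : A = B :|: (A :\: B) by rewrite -{1}(setIidPr sBA) setID.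
  apply: partitionU1 => //; first by rewrite -card_gt0.
  by rewrite disjoint_sym -setI_eq0 setDE -setIA [~: B :&: B]setIC setICr setI0.
- by rewrite cardsU1 nQ add1n eqSS.
- by apply/forall_inP => C /setU1P[->|/aQ].
Qed.

Lemma block_partitionsS A k :
  (k.+1 * #|block_partitions a A k.+1| =
   \sum_(B : {set T} | [&& B \subset A, 0 < #|B| & a #|B|])
     #|block_partitions a (A :\: B) k|)%N.
Proof.
have -> : (k.+1 * #|block_partitions a A k.+1| =
    \sum_(P in block_partitions a A k.+1) \sum_(B in P) 1)%N.
  rewrite mulnC -sum_nat_const; apply: eq_bigr => P.
  by rewrite sum1_card inE => /and3P[_ /eqP].
rewrite (exchange_big_dep predT) //= [RHS]big_mkcond /=.
by apply: eq_bigr => B _; rewrite sum1dep_card card_block_partitions_mem.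
Qed.

Local Open Scope ring_scope.

Lemma sum_subset_card (R : nmodType) A (F : nat -> R) :
  \sum_(B : {set T} | B \subset A) F #|B| =
  \sum_(j < #|A|.+1) F j *+ 'C(#|A|, j).
Proof.
(* The default value of [inord] is never reached, since [B \subset A] bounds [#|B|] by [#|A|]. *)
pose c B : 'I_#|A|.+1 := inord #|B|.
rewrite (partition_big c predT) //=; apply: eq_bigr => j _.
rewrite -cards_draws -sumr_const big_set /=; apply: eq_big => [B|B].
  apply: andb_id2l => sBA.
  by rewrite -(inj_eq val_inj) /c /= inordK // ltnS subset_leq_card.
by case/andP => sBA /eqP <-; rewrite /c inordK // ltnS subset_leq_card.
Qed.

(** Induction on [k] for all [A] at once. Since C(n, j) (n-j)! = n! / j!, the binomial recursion for
    the counts becomes the Cauchy product that defines the next power. *)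
Lemma card_block_partitions A k :
  (k`! * #|block_partitions a A k|)%:R =
  #|A|`!%:R * fps_exp (block_series a) k #|A| :> rat.
Proof.
elim: k A => [|k IHk] A.
  rewrite block_partitions0 mul1n /fps_exp /= /fps_one cards_eq0.
  by case: eqP => [->|_]; rewrite ?cards0 ?mulr1 ?mulr0.
rewrite fps_expS factS mulnC mulnA [(_ * k.+1)%N]mulnC mulnC block_partitionsS.
rewrite big_distrr natr_sum /=.
(* By the induction hypothesis the term of a block [B] depends only on its size. *)
pose F j : rat := if (0 < j)%N && a j
  then (#|A| - j)`!%:R * fps_exp (block_series a) k (#|A| - j)%N else 0.
transitivity (\sum_(B : {set T} | B \subset A) F #|B|).
  rewrite big_mkcondr /=; apply: eq_bigr => B sBA; rewrite /F.
  by case: ifP => // _; rewrite IHk cardsD (setIidPr sBA).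
rewrite sum_subset_card mulr_sumr.
apply: eq_bigr => -[j /= lejA] _; rewrite /F /block_series.
case: ifP => _; last by rewrite mul0rn mul0r mulr0.
have jn0 : j`!%:R != 0 :> rat by rewrite pnatr_eq0 -lt0n fact_gt0.
by rewrite -(bin_fact (lejA : (j <= #|A|)%N)) !natrM; field.
Qed.

End BlockPartitions.

Local Open Scope ring_scope.

Lemma eq_fps_exp (f g : fps) k : f =1 g -> fps_exp f k =1 fps_exp g k.
Proof.
move=> eqfg; elim: k => // k IHk n; rewrite !fps_expS.
by apply: eq_bigr => i _; rewrite eqfg IHk.
Qed.

(** The minus sign contributes (-1)^k to the k-th power, and t -> -t contributes (-1)^n in degree
    n. *)
Lemma fps_exp_oppnegvar (w : fps) k n :
  fps_exp (fun j => - fps_negvar w j) k n = (-1) ^+ (k + n) * fps_exp w k n.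
Proof.
elim: k n => [|k IHk] n.
  by rewrite /fps_exp /= /fps_one; case: n => [|n]; rewrite ?mulr1 ?mulr0.
rewrite !fps_expS mulr_sumr.
apply: eq_bigr => -[i /= lein] _; rewrite IHk /fps_negvar.
(* The sign splits into the leading minus, the (-1)^i of the first factor and the sign given by
   [IHk]. *)
have -> : (k.+1 + n = (i + (k + (n - i))).+1)%N by lia.
rewrite exprS [in RHS]exprD.
by move: ((-1) ^+ i) ((-1) ^+ (k + (n - i))) => x y; ring.
Qed.

Lemma egf_block_partitions mu (a : pred nat) (z : fps) :
  z =1 (fun j => - fps_negvar (block_series a) j) ->
  egf (fun n => \sum_(k < n.+1) (-1) ^+ (n - k) * (k`!%:R / k.+1%:R ^+ mu) *
                  #|block_partitions a [set: 'I_n] k|%:R) =1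
  polylog_div mu z.
Proof.
move=> zE n; rewrite /egf /polylog_div /fps_comp mulr_suml.
apply: eq_bigr => -[k /= lekn] _; rewrite (eq_fps_exp _ zE) fps_exp_oppnegvar.
have := card_block_partitions a [set: 'I_n] k.
rewrite cardsT card_ord natrM => Sk.
have nn0 : n`!%:R != 0 :> rat by rewrite pnatr_eq0 -lt0n fact_gt0.
have -> : fps_exp (block_series a) k n =
    k`!%:R * #|block_partitions a [set: 'I_n] k|%:R / n`!%:R.
  by rewrite Sk mulrAC mulfV ?mul1r.
(* As [k <= n], the two exponents have the same parity. *)
have -> : (-1) ^+ (k + n) = (-1) ^+ (n - k) :> rat.
  by rewrite -signr_odd oddD addbC -oddB // signr_odd.
by field; rewrite nn0 expf_neq0 ?pnatr_eq0.
Qed.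

Theorem theorem1 (mu m : nat) (hmu : (1 <= mu)%N) (hm : (1 <= m)%N) :
  (egf (polyBernoulli_le mu m) =1
     polylog_div mu (fps_sub fps_one (fps_negvar (E_ m)))) /\
  (egf (polyBernoulli_ge mu m) =1
     polylog_div mu (fps_sub (fps_negvar (E_ m.-1)) (fps_negvar expseries))).
Proof.
split.
  (* The Stirling numbers unfold to [block_partitions] on the full set, so only the shape of the
     substituted series is left to check; in degree 0 the two constants 1 cancel. *)
  apply: (@egf_block_partitions mu (fun j => j <= m)%N) => -[|j].
    by rewrite /fps_sub /fps_negvar /fps_one /E_ /block_series /= !mul1r invr1 subrr oppr0.
  by rewrite /fps_sub /fps_negvar /fps_one /E_ /block_series /= sub0r.
apply: (@egf_block_partitions mu (fun j => m <= j)%N) => j.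
rewrite /fps_sub /fps_negvar /E_ /expseries /block_series.
case: m hm => // m' _ /=.
(* With [m = m'.+1], the two series cancel up to degree [m']; beyond it only the exponential
   contributes. *)
case: (leqP j m') => [_|lt_m'j]; first by rewrite andbF subrr mulr0 oppr0.
by rewrite (leq_ltn_trans _ lt_m'j) //= mulr0 sub0r.
Qed.
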